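(* In the linear-convex setting, for every $t\in\{0,\dots,T\}$ denote by $(V_t^k)_{k\in\mathbb N}$ the sequence of functions generated by the Tropical Dynamic Programming algorithm with the selection functions $\phi_t^{\mathrm{SDDP}}$ and the draws made uniformly over the singletons $K_t^k:=\{x_t^k\}$, where $(x_0^k,\dots,x_T^k)$ is an optimal trajectory for the $k$-th approximations starting from $x_0$. Then the sequence $(V_t^k)_{k\in\mathbb N}$ is non-decreasing, bounded from above by $V_t$, and converges uniformly to a function $V_t^*$ on every compact set included in $\mathrm{dom}(V_t)$. Moreover, almost surely over the draws, $V_t^*=V_t$ on $\limsup_{k\in\mathbb N}K_t^k$.
   Context: **Problem and assumptions (linear-convex setting).** $\mathbb X=\mathbb R^n$, $\mathbb U=\mathbb R^m$, $T$ a positive integer, $\overline{\mathbb R}=[-\infty,+\infty]$ with $+\infty+(-\infty)=+\infty$. $\mathrm{dom}(\phi)$ is the set where $\phi$ is finite; $\delta_X$ is $0$ on $X$, $+\infty$ elsewhere. For each $t\in\{0,\dots,T-1\}$: 1. $f_t(x,u)=A_tx+B_tu$ with matrices $A_t,B_t$ of compatible dimensions. 2. $c_t:\mathbb X\times\mathbb U\to\overline{\mathbb R}$ is proper, convex, lower semicontinuous (l.s.c.), and $L_{c_t}$-Lipschitz on $\mathrm{dom}(c_t)$. 3. $X_t$, the projection of $\mathrm{dom}(c_t)$ on $\mathbb X$, is a convex polytope with non-empty interior. 4. With $U_t(x):=\{u\in\mathbb U:(x,u)\in\mathrm{dom}(c_t),\ f_t(x,u)\in X_{t+1}\}$: $U_t(x)$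 is compact and non-empty for every $x\in X_t$; the graph of $U_t$ has non-empty interior; $U_t$ is $L_{U_t}$-Lipschitz: $U_t(x')\subset U_t(x)+L_{U_t}\|x'-x\|\,\mathbb B$ for all $x,x'\in X_t$ ($\mathbb B$ the closed unit ball). At $t=T$: $\psi:\mathbb X\to\overline{\mathbb R}$ is proper convex l.s.c., its domain $X_T:=\mathrm{dom}(\psi)$ is convex compact with non-empty interior, and $\psi$ is $C_T$-Lipschitz on $X_T$. The initial state satisfies $x_0\in X_0$. **Bellman operators.** $\mathcal B_t^u(\phi)(x):=c_t(x,u)+\phi(f_t(x,u))$, $\mathcal B_t(\phi)(x):=\inf_{u\in\mathbb U}\mathcal B_t^u(\phi)(x)$. Value functions: $V_T=\psi$, $V_t=\mathcal B_t(V_{t+1})$; one has $\mathrm{dom}(V_t)=X_t$. **Constants.** $L_T:=C_T$ and for $t<T$, $L_t>0$ is a constant such that for every convex l.s.c. proper $\phi$ with domain $X_{t+1}$ that is $L_{t+1}$-Lipschitz on $X_{t+1}$, $\mathcal B_t(\phi)$ is convex l.s.c. proper with domain $X_t$ and $L_t$-Lipschitz on $X_t$ (such constants exist). **Basic functions.** $\mathbf F_t^{\mathrm{SDDP}}$ is the set of functions equal to $x\mapsto\langle a,x\rangle+b$ on $X_t$, with $\|a\|_2\le L_t$, $b\in\mathbb R$, and $+\infty$ outside $X_t$. For $F\subset\mathbf F_t^{\mathrm{SDDP}}$, $\mathcal V_F:=\sup_{\phi\in F}\phi$. **SDDP selection functions.** For $t<T$, $F\subset\mathbf F_{t+1}^{\mathrm{SDDP}}$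 and $x$, consider the problem: minimize $c_t(x',u)+\lambda$ over $x'\in X_t$, $u\in U_t(x')$, $\lambda\in\mathbb R$, subject to $x'=x$ and $\phi(f_t(x',u))\le\lambda$ for all $\phi\in F$. Let $b$ be its optimal value and $a$ a Lagrange multiplier associated with the constraint $x'-x=0$ at the optimum, i.e. such that $(x',u,\lambda;a)$ is a stationary point of the Lagrangian $c_t(x',u)+\lambda-\langle a,x'-x\rangle$ (the other constraints being kept), with $\|a\|\le L_t$. Then $\phi_t^{\mathrm{SDDP}}(F,x):=x'\mapsto\langle a,x'-x\rangle+b+\delta_{X_t}(x')$. For $t=T$, $\phi_T^{\mathrm{SDDP}}(F,x):=x'\mapsto\langle a,x'-x\rangle+V_T(x)+\delta_{X_T}(x')$ with $a\in\partial V_T(x)$, $\|a\|\le L_T$. **Algorithm.** $F_t^0=\emptyset$ for all $t$. At iteration $k=0,1,\dots$, given trial points $(x_0^k,\dots,x_T^k)$: $F_T^{k+1}=F_T^k\cup\{\phi_T^{\mathrm{SDDP}}(F_T^k,x_T^k)\}$, then for $t=T-1,\dots,0$, $F_t^{k+1}=F_t^k\cup\{\phi_t^{\mathrm{SDDP}}(F_{t+1}^{k+1},x_t^k)\}$. $V_t^k:=\mathcal V_{F_t^k}$ (so $V_t^0\equiv-\infty$). **Optimal trajectory for the $k$-th approximations starting from $x_0$.** $x_0^k:=x_0$ and $x_{t+1}^k:=f_t(x_t^k,u_t^k)$ where $u_t^k\in\arg\min_u\mathcal B_t^u(V_{t+1}^k)(x_t^k)$, $t\in\{0,\dots,T-1\}$.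 (For $k=0$, where all $V_t^0\equiv-\infty$, the trial points are arbitrary points $x_t^0\in X_t$.) Drawing uniformly over the singletons $K_t^k$ means that the trial points at iteration $k$ are $(x_0^k,\dots,x_T^k)$. **Set limits.** $\limsup_kC_k$ is the set of all cluster points of sequences $(y_k)$ with $y_k\in C_k$. *)

(* Defs.v *)
From HB Require Import structures.
From mathcomp Require Import all_boot all_order all_algebra.
From mathcomp Require Import all_classical all_reals all_analysis.
Set Implicit Arguments.
Unset Strict Implicit.
Unset Printing Implicit Defensive.
Import Order.TTheory GRing.Theory Num.Theory.
Import numFieldNormedType.Exports.
Local Open Scope classical_set_scope.
Local Open Scope ring_scope.

(* Sums of extended reals that may be ill-defined are taken in the scope %dE,
   whose addition satisfies +oo + -oo = +oo. *)

Section ExtendedRealFunctions.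
Context {R : realType}.

Definition edom (E : Type) (g : E -> \bar R) : set E :=
  [set x | g x \is a fin_num].

Definition delta (E : Type) (X : set E) (x : E) : \bar R :=
  if `[< X x >] then 0%E else +oo%E.

Definition proper (E : Type) (g : E -> \bar R) : Prop :=
  (forall x, g x != -oo%E) /\ edom g !=set0.

Definition econvex (E : lmodType R) (g : E -> \bar R) : Prop :=
  convex_set [set p : E * R^o | (g p.1 <= (p.2 : R)%:E)%E].

Definition proper_convex_lsc (E : normedModType R) (g : E -> \bar R) : Prop :=
  [/\ proper g, econvex g & lower_semicontinuous g].

(* [nrm] is explicit because the norm carried by the matrix types is the
   sup norm. *)
Definition lipschitz_wrt (E : zmodType) (nrm : E -> R) (k : R) (A : set E)
    (g : E -> \bar R) : Prop :=
  forall x y, A x -> A y -> `|fine (g x) - fine (g y)| <= k * nrm (x - y).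

Definition is_subgradient (E : lmodType R) (g : E -> \bar R) (x : E)
    (l : E -> R) : Prop :=
  g x \is a fin_num /\ forall y, (g x + (l (y - x))%:E <= g y)%E.

(* 0 is a subgradient. *)
Definition stationary (E : lmodType R) (g : E -> \bar R) (x : E) : Prop :=
  is_subgradient g x (fun=> 0).

Definition sup_fun (E : Type) (F : set (E -> \bar R)) (x : E) : \bar R :=
  ereal_sup [set g x | g in F].

Definition argmin (E : Type) (g : E -> \bar R) : set E :=
  [set u | forall v, (g u <= g v)%E].

(* The uniform structure of \bar R is that of a bounded metric, for which
   infinite values are at finite distance from real ones; hence uniform
   convergence is stated on the (eventually finite) real values. *)
Definition cvg_uniformly_on (E : choiceType) (C : set E)
    (g : nat -> E -> \bar R) (h : E -> \bar R) : Prop :=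
  [/\ \forall k \near \oo, forall x, C x -> g k x \is a fin_num,
      forall x, C x -> h x \is a fin_num &
      {uniform C, (fun k x => fine (g k x)) @ \oo --> (fun x => fine (h x))}].

Definition limsup_set (E : topologicalType) (C : nat -> set E) : set E :=
  [set z | exists y : nat -> E,
     (forall k, C k (y k)) /\ cluster (y @ \oo) z].

End ExtendedRealFunctions.

Section Euclidean.
Context {R : realType}.

Definition dot n (a x : 'cV[R]_n) : R := \sum_i a i 0 * x i 0.

Definition norm2 n (x : 'cV[R]_n) : R := Num.sqrt (dot x x).

Definition pair_norm2 n m (p : 'cV[R]_n * 'cV[R]_m) : R :=
  Num.sqrt (norm2 p.1 ^+ 2 + norm2 p.2 ^+ 2).

Definition polytope n (X : set 'cV[R]_n) : Prop :=
  exists (p : nat) (v : 'I_p -> 'cV[R]_n),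
    X = [set x | exists w : 'I_p -> R,
           [/\ forall i, 0 <= w i, \sum_i w i = 1 & x = \sum_i w i *: v i]].

End Euclidean.

(* [cost_lip], [cstr_lip] and [final_lip] are the Lipschitz constants of the
   costs c_t, of the constraint maps U_t and of the final cost.  Families
   indexed by a time are only meaningful up to the horizon. *)
Record lc_data (R : realType) (n m : nat) := LCData {
  horizon : nat;
  lc_A : nat -> 'M[R]_n;
  lc_B : nat -> 'M[R]_(n, m);
  cost : nat -> 'cV[R]_n * 'cV[R]_m -> \bar R;
  final_cost : 'cV[R]_n -> \bar R;
  cost_lip : nat -> R;
  cstr_lip : nat -> R;
  final_lip : R }.

Section LinearConvex.
Context {R : realType} {n m : nat}.
Local Notation X := 'cV[R]_n.
Local Notation U := 'cV[R]_m.
Variable P : lc_data R n m.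
Local Notation T := (horizon P).

Definition dyn (t : nat) (x : X) (u : U) : X := lc_A P t *m x + lc_B P t *m u.

(* The set X_t. *)
Definition state_set (t : nat) : set X :=
  if t == T then edom (final_cost P)
  else [set x | exists u, edom (cost P t) (x, u)].

(* The set U_t(x). *)
Definition ctrl_set (t : nat) (x : X) : set U :=
  [set u | edom (cost P t) (x, u) /\ state_set t.+1 (dyn t x u)].

Record linear_convex : Prop := LinearConvex {
  horizon_gt0 : (0 < T)%N;
  cost_pcl : forall t, (t < T)%N -> proper_convex_lsc (cost P t);
  cost_lipP : forall t, (t < T)%N ->
    lipschitz_wrt (@pair_norm2 R n m) (cost_lip P t) (edom (cost P t))
      (cost P t);
  state_polytope : forall t, (t < T)%N -> polytope (state_set t);
  state_interior : forall t, (t < T)%N -> (state_set t)° !=set0;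
  ctrl_compact : forall t x, (t < T)%N -> state_set t x ->
    compact (ctrl_set t x);
  ctrl_neq0 : forall t x, (t < T)%N -> state_set t x -> ctrl_set t x !=set0;
  ctrl_graph_interior : forall t, (t < T)%N ->
    [set p : X * U | ctrl_set t p.1 p.2]° !=set0;
  ctrl_lipP : forall t x x', (t < T)%N -> state_set t x -> state_set t x' ->
    ctrl_set t x' `<=`
      [set w | exists u v : U, [/\ ctrl_set t x u, norm2 v <= 1 &
                 w = u + (cstr_lip P t * norm2 (x' - x)) *: v]];
  final_pcl : proper_convex_lsc (final_cost P);
  final_convex : convex_set (state_set T);
  final_compact : compact (state_set T);
  final_interior : (state_set T)° !=set0;
  final_lipP :
    lipschitz_wrt (@norm2 R n) (final_lip P) (state_set T) (final_cost P) }.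

Definition bellman_u (t : nat) (u : U) (phi : X -> \bar R) (x : X) : \bar R :=
  (cost P t (x, u) + phi (dyn t x u))%dE.

Definition bellman (t : nat) (phi : X -> \bar R) (x : X) : \bar R :=
  ereal_inf [set bellman_u t u phi x | u in [set: U]].

(* [value_to_go s] is the value function at time T - s. *)
Fixpoint value_to_go (s : nat) : X -> \bar R :=
  if s is s'.+1 then bellman (T - s'.+1) (value_to_go s')
  else final_cost P.

Definition value (t : nat) : X -> \bar R := value_to_go (T - t).

Definition lip_constants (L : nat -> R) : Prop :=
  L T = final_lip P /\
  forall t, (t < T)%N ->
    0 < L t /\
    forall phi : X -> \bar R, proper_convex_lsc phi ->
      edom phi = state_set t.+1 ->
      lipschitz_wrt (@norm2 R n) (L t.+1) (state_set t.+1) phi ->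
      [/\ proper_convex_lsc (bellman t phi),
          edom (bellman t phi) = state_set t &
          lipschitz_wrt (@norm2 R n) (L t) (state_set t) (bellman t phi)].

Definition sddp_basic (L : nat -> R) (t : nat) : set (X -> \bar R) :=
  [set phi | exists (a : X) (b : R), norm2 a <= L t /\
     phi = (fun x => (dot a x + b)%:E + delta (state_set t) x)%dE].

Definition sddp_cut (t : nat) (a : X) (b : R) (x : X) : X -> \bar R :=
  fun x' => ((dot a (x' - x) + b)%:E + delta (state_set t) x')%dE.

(* The pair ((x', u), lambda) satisfies all the constraints but x' = x. *)
Definition sddp_constraints (t : nat) (F : set (X -> \bar R)) :
    set (X * U * R^o) :=
  [set z | [/\ state_set t z.1.1, ctrl_set t z.1.1 z.1.2 &
     forall phi, F phi -> (phi (dyn t z.1.1 z.1.2) <= (z.2 : R)%:E)%E]].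

Definition sddp_objective (t : nat) (z : X * U * R^o) : \bar R :=
  (cost P t z.1 + (z.2 : R)%:E)%dE.

Definition sddp_optval (t : nat) (F : set (X -> \bar R)) (x : X) : \bar R :=
  ereal_inf [set sddp_objective t z |
               z in sddp_constraints t F `&` [set z | z.1.1 = x]].

(* Only the constraint x' = x is dualized: the other ones are kept through the
   indicator function, so that stationarity is 0 \in d(L + delta), and
   stationarity in the multiplier is the condition x' = x of
   [sddp_optimum]. *)
Definition sddp_lagrangian (t : nat) (F : set (X -> \bar R)) (x a : X)
    (z : X * U * R^o) : \bar R :=
  (sddp_objective t z - (dot a (z.1.1 - x))%:E
     + delta (sddp_constraints t F) z)%dE.

Definition sddp_optimum (t : nat) (F : set (X -> \bar R)) (x : X) :
    set (X * U * R^o) :=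
  [set z | [/\ sddp_constraints t F z, z.1.1 = x &
               sddp_objective t z = sddp_optval t F x]].

Definition sddp_multiplier (t : nat) (F : set (X -> \bar R)) (x a : X) : Prop :=
  exists2 z, sddp_optimum t F x z & stationary (sddp_lagrangian t F x a) z.

(* For t < T the specification bears on the nonempty finite F only: the problem
   is unbounded below for the empty F and may be infeasible for infinite ones,
   in which cases there is no real optimal value. *)
Definition sddp_selection (L : nat -> R)
    (sel : nat -> set (X -> \bar R) -> X -> (X -> \bar R)) : Prop :=
  (forall t F x, (t < T)%N -> finite_set F -> F !=set0 ->
     F `<=` sddp_basic L t.+1 -> state_set t x ->
     exists (a : X) (b : R),
       [/\ norm2 a <= L t, sddp_optval t F x = b%:E, sddp_multiplier t F x a &
           sel t F x = sddp_cut t a b x]) /\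
  (forall F x, F `<=` sddp_basic L T -> state_set T x ->
     exists a : X,
       [/\ norm2 a <= L T, is_subgradient (value T) x (dot a) &
           sel T F x = sddp_cut T a (fine (value T x)) x]).

(* [F k t] is the set of basic functions F_t^k and [x k t] the trial point
   x_t^k.  A uniform draw over the singleton {x_t^k} has x_t^k as its only
   outcome, so the trial points need no probability space. *)
Definition tdp_run (sel : nat -> set (X -> \bar R) -> X -> (X -> \bar R))
    (x : nat -> nat -> X) (F : nat -> nat -> set (X -> \bar R)) : Prop :=
  [/\ forall t, (t <= T)%N -> F 0%N t = set0,
      forall k, F k.+1 T = F k T `|` [set sel T (F k T) (x k T)] &
      forall k t, (t < T)%N ->
        F k.+1 t = F k t `|` [set sel t (F k.+1 t.+1) (x k t)]].

Definition optimal_trajectory (V : nat -> X -> \bar R) (x0 : X)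
    (x : nat -> X) : Prop :=
  x 0%N = x0 /\
  forall t, (t < T)%N ->
    exists2 u, argmin (fun u => bellman_u t u (V t.+1) (x t)) u &
               x t.+1 = dyn t (x t) u.

(* The approximations of index 0 are identically -oo and the corresponding
   trial points are arbitrary. *)
Definition optimal_trials (x0 : X) (V : nat -> nat -> X -> \bar R)
    (x : nat -> nat -> X) : Prop :=
  (forall t, (t <= T)%N -> state_set t (x 0%N t)) /\
  (forall k, (0 < k)%N -> optimal_trajectory (V k) x0 (x k)).

End LinearConvex.

(* Main.v *)
Require Import Defs.
From HB Require Import structures.
From mathcomp Require Import all_boot all_order all_algebra.
From mathcomp Require Import all_classical all_reals all_analysis.
From mathcomp Require Import ring lra.
Set Implicit Arguments.
Unset Strict Implicit.
Unset Printing Implicit Defensive.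
Import Order.TTheory GRing.Theory Num.Theory.
Import DualAddTheory.
Import numFieldNormedType.Exports.
Local Open Scope classical_set_scope.
Local Open Scope ring_scope.

(** Write V_t for the value functions and V_t^k for the approximations, and let
    X_t be the domain of V_t.

    Every cut minorizes: stationarity of the Lagrangian at the optimum says that
    the affine function built from the optimal value and the multiplier stays
    below the costs of all feasible triples of a state, a control and a level,
    hence below the Bellman image of the model V_{t+1}^{k+1}, and at the trial
    point it takes exactly the value of that image ([selected_cut]).  By
    backward induction in t and forward induction in k, the models stay below
    the value functions and the trial points stay in the sets X_t
    ([run_invariants]).

    On X_t all the models share one Lipschitz constant, because the slopes of
    the cuts are bounded by L_t ([lower_model_lipschitz]).  The models increase
    pointwise to the supremum V_t^* of all the cuts ever added, and on a compact
    set pointwise convergence of functions with a common Lipschitz constant is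
    uniform ([lipschitz_cvg_uniform]).

    To identify V_t^* at cluster points, consider the gap
    g_t^k = V_t(x_t^k) - V_t^{k+1}(x_t^k) at the trial points.  The control
    u_t^k that produces x_{t+1}^k is optimal for the model V_{t+1}^k, so
    V_t^{k+1}(x_t^k) is at least the cost of u_t^k plus V_{t+1}^k(x_{t+1}^k),
    while V_t(x_t^k) is at most the same cost plus V_{t+1}(x_{t+1}^k).
    Subtracting ([gap_recursion]),
      g_t^k <= g_{t+1}^k + (V_{t+1}^{k+1} - V_{t+1}^k)(x_{t+1}^k)   (k > 0).
    The last term tends to 0 because the models converge uniformly on the
    compact set X_{t+1}, and g_T^k = 0 because the final cut is exact; so the
    gaps tend to 0 for every t ([gap_cvg0]).  Since V_t^* and V_t are Lipschitz on the
    closed set X_t, they agree at every cluster point of the trial points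
    ([limit_model_cluster]). *)

(** * The Euclidean norm against the sup norm *)

Section EuclideanNorm.
Context {R : realType} {n : nat}.
Implicit Types a x y : 'cV[R]_n.

Lemma coord_le_norm2 a i : `|a i 0| <= norm2 a.
Proof.
rewrite -sqrtr_sqr /norm2 ler_sqrt; last first.
  by apply: sumr_ge0 => j _; rewrite -expr2 sqr_ge0.
rewrite /dot (bigD1 i)//= -expr2 lerDl.
by apply: sumr_ge0 => j _; rewrite -expr2 sqr_ge0.
Qed.

Lemma norm2_ge0 a : 0 <= norm2 a.
Proof. exact: sqrtr_ge0. Qed.

Lemma coord_le_norm a i : `|a i 0| <= `|a|.
Proof.
rewrite [leRHS]mx_normrE.
exact: (le_bigmax _ (fun ij : 'I_n * 'I_1 => `|a ij.1 ij.2|) (i, 0)).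
Qed.

Lemma sum_le_bound (f : 'I_n -> R) c :
  (forall i, f i <= c) -> \sum_i f i <= n%:R * c.
Proof.
by move=> fc; rewrite mulr_natl -[X in _ *+ X]card_ord -sumr_const ler_sum.
Qed.

(** A dimension-dependent constant is harmless here, and it spares the
    Cauchy-Schwarz inequality. *)
Lemma dot_le_norm a x : `|dot a x| <= n%:R * norm2 a * `|x|.
Proof.
apply: le_trans (ler_norm_sum _ _ _) _.
rewrite -mulrA; apply: sum_le_bound => i.
by rewrite normrM ler_pM ?coord_le_norm2 ?coord_le_norm.
Qed.

Lemma norm2_le_norm x : norm2 x <= n%:R * `|x|.
Proof.
rewrite -[leRHS]ger0_norm ?mulr_ge0// -sqrtr_sqr /norm2 ler_sqrt ?sqr_ge0//.
apply: (@le_trans _ _ (n%:R * `|x| ^+ 2)).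
  apply: sum_le_bound => i.
  by rewrite -expr2 -real_normK ?num_real// lerXn2r ?nnegrE// coord_le_norm.
rewrite exprMn ler_wpM2r ?sqr_ge0//.
by rewrite -natrX ler_nat; case: (n) => // k; rewrite leq_pmulr.
Qed.

Lemma dotBr a x y : dot a (x - y) = dot a x - dot a y.
Proof.
by rewrite -sumrB; apply: eq_bigr => i _; rewrite !mxE mulrBr.
Qed.

Lemma dot_0r a : dot a 0 = 0.
Proof. by rewrite /dot big1// => i _; rewrite mxE mulr0. Qed.

End EuclideanNorm.

(** * Uniform convergence on compact sets *)

Section UniformConvergence.
Context {R : realType}.

(** Around each point [x] of [C], the common Lipschitz bound transfers the
    convergence at [x] to a whole ball, with the same rank for all its points;
    finitely many such balls cover [C]. *)
Lemma lipschitz_cvg_uniform (E : normedModType R) (C : set E) (K : R)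
    (g : nat -> E -> R) (h : E -> R) :
  compact C ->
  (\forall k \near \oo, forall x y, C x -> C y ->
     `|g k x - g k y| <= K * `|x - y|) ->
  (forall x y, C x -> C y -> `|h x - h y| <= K * `|x - y|) ->
  (forall x, C x -> g k x @[k --> \oo] --> h x) ->
  forall e, 0 < e -> \forall k \near \oo, forall x, C x -> `|g k x - h x| < e.
Proof.
move=> /compact_near_coveringP/near_covering_withinP cC gK hK gh e e0.
(* [K] may be zero or negative, hence the radius e / 3 / (|K| + 1). *)
have K1 : 0 < `|K| + 1 by rewrite ltr_wpDl.
have d0 : 0 < e / 3 / (`|K| + 1) by rewrite !divr_gt0.
have near_lip (d : R) : d < e / 3 / (`|K| + 1) -> 0 <= d -> K * d < e / 3.
  rewrite ltr_pdivlMr// => dlt d_ge0; apply: le_lt_trans dlt.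
  rewrite mulrC ler_wpM2l//; have := ler_norm K; lra.
apply: (cC nat \oo (fun k x => `|g k x - h x| < e)) => x Cx.
have e3 : 0 < e / 3 by rewrite divr_gt0.
have /cvgrPdist_lt /(_ _ e3) ghx := gh x Cx.
exists (ball x (e / 3 / (`|K| + 1)),
        [set k | `|h x - g k x| < e / 3 /\ forall x y, C x -> C y ->
           `|g k x - g k y| <= K * `|x - y|]).
  split=> /=; first exact: nbhsx_ballx.
  by near=> k; split; near: k.
move=> [y k] /= [xy [hgk gkK]] Cy.
rewrite -ball_normE/= in xy.
have xyK := near_lip _ xy (normr_ge0 _).
have := gkK _ _ Cy Cx; have := hK _ _ Cx Cy; rewrite (distrC y x).
move=> h1 h2.
have -> : g k y - h y = (g k y - g k x) + - (h x - g k x) + (h x - h y) by ring.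
apply: le_lt_trans (ler_normD _ _) _.
have := ler_normD (g k y - g k x) (- (h x - g k x)).
rewrite normrN; lra.
Unshelve. all: by end_near. Qed.

Lemma cvg_uniformly_onP (E : choiceType) (C : set E) (g : nat -> E -> \bar R)
    (h : E -> \bar R) :
  (\forall k \near \oo, forall x, C x -> g k x \is a fin_num) ->
  (forall x, C x -> h x \is a fin_num) ->
  (forall e, 0 < e -> \forall k \near \oo, forall x, C x ->
     `|fine (g k x) - fine (h x)| < e) ->
  cvg_uniformly_on C g h.
Proof.
move=> gfin hfin gh; split=> // A /uniform_nbhs [B [entB BA]].
move: entB; rewrite -entourage_ballE => -[e /= e0 eB].
have := gh e e0; apply: filterS => k ghk.
apply: BA => x Cx; apply: eB => /=.
by rewrite -ball_normE/= distrC ghk.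
Qed.

End UniformConvergence.

(** * Compactness of polytopes *)

Section Polytope.
Context {R : realType} {n : nat}.

(** A polytope is the image of the standard simplex under a linear map, and the
    simplex is a closed part of a cube. *)
Lemma polytope_compact (X : set 'cV[R]_n) : polytope X -> compact X.
Proof.
move=> [p [v ->]].
pose S : set 'rV[R]_p := [set w | (forall i, `[0, 1]%classic (w 0 i))] `&`
  [set w | \sum_i w 0 i = 1].
pose f (w : 'rV[R]_p) := \sum_i w 0 i *: v i.
have cS : compact S.
  apply: compact_closedI.
    have := @rV_compact R p (fun=> `[0, 1]%classic).
    by apply=> i; exact: segment_compact.
  apply: (@preimage_closed _ _ (fun w : 'rV[R]_p => \sum_i w 0 i) [set 1]).
    move=> w _; apply: (continuous_big (@add_continuous R^o)) => i _.
    exact: coord_continuous.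
  exact: closed_eq.
have cf : continuous f.
  apply: (continuous_big (@add_continuous 'cV[R]_n)) => i _ w.
  have coord_w := @coord_continuous R 1 p 0 i w.
  exact: (@cvgZ _ _ _ (nbhs w) _ _ (fun=> v i) _ _ coord_w (cvg_cst _)).
suff -> : [set x | exists w : 'I_p -> R,
    [/\ forall i, 0 <= w i, \sum_i w i = 1 & x = \sum_i w i *: v i]] = f @` S.
  by apply: continuous_compact => //; exact: continuous_subspaceT.
apply/seteqP; split=> [_ [w [w0 w1 ->]]|_ [w [w01 w1] <-]].
  exists (\row_i w i); last by apply: eq_bigr => i _; rewrite mxE.
  split=> /=; last by under eq_bigr do rewrite mxE.
  move=> i; rewrite mxE in_itv/= w0/= -w1 (bigD1 i)//= lerDl.
  by apply: sumr_ge0.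
exists (w 0); split=> // i; have /= := w01 i.
by rewrite in_itv/= => /andP[].
Qed.

End Polytope.

(** * Regularity of the value functions *)

Lemma backward_ind (T : nat) (Q : nat -> Prop) :
  Q T -> (forall t, (t < T)%N -> Q t.+1 -> Q t) ->
  forall t, (t <= T)%N -> Q t.
Proof.
move=> QT QS t tT; rewrite -(subKn tT).
elim: (T - t)%N (leq_subr t T) => [|s IH] sT; first by rewrite subn0.
apply: QS; first by rewrite ltn_subrL (leq_trans _ sT).
by rewrite -subSn// subSS; apply: IH; exact: ltnW.
Qed.

Section ValueFunctions.
Context {R : realType} {n m : nat} {P : lc_data R n m}.
Hypothesis hP : linear_convex P.
Local Notation T := (horizon P).

Lemma value_horizon : value P T = final_cost P.
Proof. by rewrite /value subnn. Qed.

Lemma value_bellman t : (t < T)%N -> value P t = bellman P t (value P t.+1).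
Proof.
by move=> tT; rewrite /value -(subnSK tT) /= subnSK// subKn// ltnW.
Qed.

Lemma state_compact t : (t <= T)%N -> compact (state_set P t).
Proof.
rewrite leq_eqVlt => /predU1P[->|tT]; first exact: final_compact.
by apply: polytope_compact; exact: state_polytope.
Qed.

Context {L : nat -> R}.
Hypothesis hL : lip_constants P L.

(** The property that defines the constants [L t] passes regularity from one
    value function to the preceding one. *)
Lemma value_regular t : (t <= T)%N ->
  [/\ proper_convex_lsc (value P t), edom (value P t) = state_set P t &
      lipschitz_wrt (@norm2 R n) (L t) (state_set P t) (value P t)].
Proof.
case: hL => LT Lt; move: t; apply: backward_ind => [|t tT [pcl dom lip]].
  rewrite value_horizon LT; split.
  - exact: final_pcl.
  - by rewrite /state_set eqxx.
  - exact: final_lipP.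
by rewrite value_bellman//; have [_] := Lt t tT; exact.
Qed.

Lemma value_fin t y : (t <= T)%N -> state_set P t y ->
  value P t y \is a fin_num.
Proof. by move=> /value_regular[_ <-]. Qed.

Lemma value_notin t y : (t <= T)%N -> ~ state_set P t y ->
  value P t y = +oo%E.
Proof.
move=> /value_regular[[[vNy _] _ _] <- _] /= /negP.
by rewrite fin_numE vNy//= negbK => /eqP.
Qed.

(** The sign of [L T] is not prescribed, hence the absolute value. *)
Lemma value_lipschitz t : (t <= T)%N ->
  lipschitz_wrt Num.norm (n%:R * `|L t|) (state_set P t) (value P t).
Proof.
move=> /value_regular[_ _ lip] x y Xx Xy; apply: le_trans (lip x y Xx Xy) _.
apply: (@le_trans _ _ (`|L t| * norm2 (x - y))).
  by rewrite ler_wpM2r ?norm2_ge0 ?ler_norm.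
by rewrite (mulrC n%:R) -mulrA ler_wpM2l// norm2_le_norm.
Qed.

End ValueFunctions.

(** * Models made of affine cuts *)

(** The models V_t^k with k > 0 are suprema of such sets, and so is their limit.
    Nonemptiness gives the value +oo outside the state set and excludes -oo. *)
Definition lower_model (R : realType) (n m : nat) (P : lc_data R n m)
    (L : nat -> R) (t : nat) (G : set ('cV[R]_n -> \bar R)) : Prop :=
  [/\ G `<=` sddp_basic P L t, G !=set0 &
      forall y, (sup_fun G y <= value P t y)%E].

Section BasicFunctions.
Context {R : realType} {n m : nat} {P : lc_data R n m}.
Hypothesis hP : linear_convex P.
Context {L : nat -> R}.
Hypothesis hL : lip_constants P L.
Local Notation T := (horizon P).
Local Notation X := 'cV[R]_n.
Implicit Types (phi : X -> \bar R) (G : set (X -> \bar R)).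

Lemma basic_in t phi x : sddp_basic P L t phi -> state_set P t x ->
  exists a b, [/\ norm2 a <= L t, phi x = (dot a x + b)%:E &
    forall y, state_set P t y -> phi y = (dot a y + b)%:E].
Proof.
move=> [a [b [aL ->]]] Xx; exists a, b.
have phiE y : state_set P t y ->
    ((dot a y + b)%:E + delta (state_set P t) y)%dE = (dot a y + b)%:E.
  by move=> Xy; rewrite /delta asboolT//= addr0.
by split => //; exact: phiE.
Qed.

Lemma basic_notin t phi x :
  sddp_basic P L t phi -> ~ state_set P t x -> phi x = +oo%E.
Proof. by move=> [a [b [_ ->]]] Xx; rewrite /delta asboolF. Qed.

Lemma cut_basic t a b x :
  norm2 a <= L t -> sddp_basic P L t (sddp_cut P t a b x).
Proof.
move=> aL; exists a, (b - dot a x); split=> //.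
by apply/funext => y; rewrite /sddp_cut dotBr addrAC addrA.
Qed.

Lemma cutE t a b x y : state_set P t y ->
  sddp_cut P t a b x y = (dot a (y - x) + b)%:E.
Proof. by move=> Xy; rewrite /sddp_cut /delta asboolT//= addr0. Qed.

Lemma sup_basic_gtNy t G y :
  G `<=` sddp_basic P L t -> G !=set0 -> (-oo < sup_fun G y)%E.
Proof.
move=> GB [phi Gphi]; apply: (@lt_le_trans _ _ (phi y)); last first.
  by apply: ereal_sup_ubound; exists phi.
have [Xy|Xy] := pselect (state_set P t y).
  by have [a [b [_ -> _]]] := basic_in (GB _ Gphi) Xy; rewrite ltNyr.
by rewrite (basic_notin (GB _ Gphi) Xy).
Qed.

Lemma sup_basic_notin t G y :
  G `<=` sddp_basic P L t -> G !=set0 -> ~ state_set P t y ->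
  sup_fun G y = +oo%E.
Proof.
move=> GB [phi Gphi] Xy; apply/eqP; rewrite -leye_eq.
rewrite -(basic_notin (GB _ Gphi) Xy).
by apply: ereal_sup_ubound; exists phi.
Qed.

Lemma lower_model_fin t G y : (t <= T)%N ->
  lower_model P L t G -> state_set P t y -> sup_fun G y \is a fin_num.
Proof.
move=> tT [GB G0 GV] Xy; rewrite fin_real// (sup_basic_gtNy _ GB G0)/=.
apply: le_lt_trans (GV y) _.
by have := value_fin hP hL tT Xy; rewrite fin_numElt => /andP[].
Qed.

(** The slopes of basic functions are bounded by [L t], whatever the number of
    cuts: the constant is the same for all models at time [t]. *)
Lemma lower_model_lipschitz t G : (t <= T)%N -> lower_model P L t G ->
  lipschitz_wrt Num.norm (n%:R * `|L t|) (state_set P t) (sup_fun G).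
Proof.
move=> tT lmG.
have lip x y : state_set P t x -> state_set P t y ->
    fine (sup_fun G x) <= fine (sup_fun G y) + n%:R * `|L t| * `|x - y|.
  move=> Xx Xy; rewrite -lee_fin EFinD !fineK ?(lower_model_fin tT lmG)//.
  apply: ge_ereal_sup => _ [phi Gphi <-].
  have [GB _ _] := lmG.
  have [a [b [aL -> /(_ _ Xy) phiy]]] := basic_in (GB _ Gphi) Xx.
  apply: (@le_trans _ _ (phi y + (n%:R * `|L t| * `|x - y|)%:E)%E); last first.
    by rewrite leeD2r//; apply: ereal_sup_ubound; exists phi.
  rewrite phiy -EFinD lee_fin addrAC lerD2r -lerBlDl -dotBr.
  apply: le_trans (ler_norm _) _; apply: le_trans (dot_le_norm _ _) _.
  by rewrite ler_wpM2r// ler_wpM2l// (le_trans aL) ?ler_norm.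
move=> x y Xx Xy; rewrite ler_norml; apply/andP; split.
  by rewrite lerBrDr addrC lerBlDr distrC lip.
by rewrite lerBlDl lip.
Qed.

End BasicFunctions.

(** * The selected cuts *)

Section Cuts.
Context {R : realType} {n m : nat} {P : lc_data R n m}.
Hypothesis hP : linear_convex P.
Context {L : nat -> R}.
Hypothesis hL : lip_constants P L.
Local Notation T := (horizon P).
Local Notation X := 'cV[R]_n.

Lemma bellman_u_le t u (g h : X -> \bar R) x :
  (forall y, (g y <= h y)%E) ->
  (bellman_u P t u g x <= bellman_u P t u h x)%E.
Proof. by move=> gh; exact: lee_dD. Qed.

Lemma value_le_bellman_u t u x : (t < T)%N ->
  (value P t x <= bellman_u P t u (value P t.+1) x)%E.
Proof.
by move=> tT; rewrite value_bellman//; apply: ereal_inf_lbound; exists u.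
Qed.

(** Since the cost is never -oo, a sum below +oo has both terms below +oo: a
    control of finite value is admissible. *)
Lemma bellman_u_lty t u (g : X -> \bar R) x : (t < T)%N ->
  (forall y, ~ state_set P t.+1 y -> g y = +oo%E) ->
  (bellman_u P t u g x < +oo)%E ->
  [/\ state_set P t x, ctrl_set P t x u & (g (dyn P t x u) < +oo)%E].
Proof.
move=> tT goo; rewrite /bellman_u.
have [[cNy _] _ _] := cost_pcl hP tT.
have := cNy (x, u); case cxu: (cost P t (x, u)) => [c| |]// _.
have cfin : edom (cost P t) (x, u) by rewrite /edom /= cxu.
have Xx : state_set P t x by rewrite /state_set (ltn_eqF tT); exists u.
move=> lt_sum; have gdlt : (g (dyn P t x u) < +oo)%E.
  by move: lt_sum; case: (g (dyn P t x u)) => //= r; rewrite !ltry.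
by split=> //; split=> //; apply: contrapT => /goo gdy; rewrite gdy in gdlt.
Qed.

Context {sel : nat -> set (X -> \bar R) -> X -> (X -> \bar R)}.
Hypothesis hsel : sddp_selection P L sel.

(** The second clause is stationarity of the Lagrangian, tested at the points
    ((y, u), l) whose level l is the value of the model at the next state.  The
    third one holds for the optimal control, since the optimal level dominates
    the model at the next state. *)
Lemma selected_cut t G x : (t < T)%N -> finite_set G ->
  lower_model P L t.+1 G -> state_set P t x ->
  [/\ sddp_basic P L t (sel t G x),
      forall y u, (sel t G x y <= bellman_u P t u (sup_fun G) y)%E &
      exists u, (bellman_u P t u (sup_fun G) x <= sel t G x x)%E].
Proof.
move=> tT finG lmG Xx; have [GB G0 GV] := lmG.
have [/(_ t G x tT finG G0 GB Xx) + _] := hsel.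
move=> [a [b [aL bopt [z [zF zx zopt] [_ zmin]] ->]]].
move: z zF zx zopt zmin => [[x' u] l] zF /= x'x; rewrite bopt {}x'x in zF *.
move=> zopt zmin.
have [/= _ [cxu _] Gl] := zF.
rewrite /edom/= in cxu.
split; first exact: cut_basic.
  move=> y v; rewrite leNgt; apply/negP => lt_cut.
  have [] := @bellman_u_lty t v (sup_fun G) y tT.
  - by move=> w; exact: (sup_basic_notin GB G0).
  - exact: lt_le_trans lt_cut (leey _).
  move=> Xy Uv sfin.
  have {}sfin := lower_model_fin hP hL tT lmG (Uv.2).
  have cfin : cost P t (y, v) \is a fin_num := Uv.1.
  have zF' : sddp_constraints P t G ((y, v), fine (sup_fun G (dyn P t y v))).
    split=> //= phi Gphi; rewrite fineK//.
    by apply: ereal_sup_ubound; exists phi.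
  have := zmin ((y, v), fine (sup_fun G (dyn P t y v))).
  rewrite /sddp_lagrangian zopt /delta !asboolT//=.
  move: lt_cut; rewrite cutE// /bellman_u /sddp_objective /=.
  rewrite -(fineK cfin) -[sup_fun _ _](fineK sfin) /=.
  rewrite lte_fin lee_fin subrr dot_0r; lra.
exists u; rewrite cutE// subrr dot_0r add0r -zopt; apply: lee_dD => //.
by apply: ge_ereal_sup => _ [phi Gphi <-]; exact: Gl.
Qed.

Lemma selected_final_cut G x : G `<=` sddp_basic P L T -> state_set P T x ->
  [/\ sddp_basic P L T (sel T G x),
      forall y, (sel T G x y <= value P T y)%E &
      sel T G x x = value P T x].
Proof.
move=> GB Xx; have [_ /(_ G x GB Xx) [a [aL [Vfin Vsub] ->]]] := hsel.
split; first exact: cut_basic.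
- move=> y; have [Xy|Xy] := pselect (state_set P T y); last first.
    by rewrite (value_notin hP hL (leqnn _) Xy) leey.
  by rewrite cutE// EFinD fineK// addeC.
- by rewrite cutE// subrr dot_0r add0r fineK.
Qed.

End Cuts.

(** * Invariants of the algorithm and convergence *)

(** The limit V_t^* is encoded as the supremum of this set of cuts, rather than
    as a supremum of functions, so that it inherits every property of a
    [lower_model]. *)
Definition limit_model (E : Type) (F : nat -> nat -> set E) (t : nat) : set E :=
  \bigcup_k F k t.

Section Convergence.
Context {R : realType} {n m : nat} {P : lc_data R n m}.
Hypothesis hP : linear_convex P.
Context {L : nat -> R}.
Hypothesis hL : lip_constants P L.
Local Notation T := (horizon P).
Local Notation X := 'cV[R]_n.
Context {sel : nat -> set (X -> \bar R) -> X -> (X -> \bar R)}.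
Hypothesis hsel : sddp_selection P L sel.
Context {x0 : X}.
Hypothesis hx0 : state_set P 0%N x0.
Context {x : nat -> nat -> X} {F : nat -> nat -> set (X -> \bar R)}.
Hypothesis hF : tdp_run P sel x F.
Hypothesis hx : optimal_trials P x0 (fun k t => sup_fun (F k t)) x.

Lemma run_subset k t : (t <= T)%N -> F k t `<=` F k.+1 t.
Proof.
have [_ FT FS] := hF.
rewrite leq_eqVlt => /predU1P[->|tT].
  by rewrite FT; exact: subsetUl.
by rewrite (FS k t tT); exact: subsetUl.
Qed.

Lemma run_nondecreasing t y : (t <= T)%N ->
  nondecreasing_seq (fun k => sup_fun (F k t) y).
Proof.
move=> tT; apply/nondecreasing_seqP => k.
apply: ereal_sup_le => _ [phi Fphi <-].
by exists phi => //; exact: run_subset Fphi.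
Qed.

(** An optimal control has finite value, because an admissible one exists; the
    model being +oo outside the state set, the next state lies inside. *)
Lemma optimal_trajectory_in_states k : (0 < k)%N ->
  (forall t, (t <= T)%N -> lower_model P L t (F k t)) ->
  forall t, (t <= T)%N -> state_set P t (x k t).
Proof.
move=> k0 lmF; have [_ /(_ k k0) [x0E xS]] := hx.
elim=> [_|t IH tT]; first by rewrite x0E.
have [u umin ->] := xS t tT.
have Xt := IH (ltnW tT).
have [v [cv Xv]] := ctrl_neq0 hP tT Xt.
have [FB F0 _] := lmF _ tT.
have lt_sum : (bellman_u P t u (sup_fun (F k t.+1)) (x k t) < +oo)%E.
  apply: le_lt_trans (umin v) _.
  have Vfin := lower_model_fin hP hL tT (lmF _ tT) Xv.
  by rewrite /bellman_u -(fineK cv) -(fineK Vfin) -dEFinD ltry.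
by have [_ []] := bellman_u_lty hP tT (fun y => sup_basic_notin FB F0) lt_sum.
Qed.

Lemma lower_modelU1 t G phi :
  G `<=` sddp_basic P L t -> (forall y, (sup_fun G y <= value P t y)%E) ->
  sddp_basic P L t phi -> (forall y, (phi y <= value P t y)%E) ->
  lower_model P L t (G `|` [set phi]).
Proof.
move=> GB GV phiB phiV; split.
- by move=> psi [/GB//|->].
- by exists phi; right.
- move=> y; apply: ge_ereal_sup => _ [psi [Gpsi|->] <-] //.
  by apply: le_trans (GV y); apply: ereal_sup_ubound; exists psi.
Qed.

(** Nonemptiness fails at rank 0, so that [lower_model] is not an invariant by
    itself; it holds for all positive ranks, by [run_step]. *)
Definition run_invariant k := forall t, (t <= T)%N ->
  [/\ finite_set (F k t), F k t `<=` sddp_basic P L t &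
      forall y, (sup_fun (F k t) y <= value P t y)%E].

(** Induction goes backward in time, since the cut at time [t] is computed from
    the model of rank [k.+1] at time [t.+1]. *)
Lemma run_step k : run_invariant k ->
  (forall t, (t <= T)%N -> state_set P t (x k t)) ->
  forall t, (t <= T)%N -> finite_set (F k.+1 t) /\ lower_model P L t (F k.+1 t).
Proof.
have [_ FT FS] := hF.
move=> inv Xx; apply: backward_ind => [|t tT [finS lmS]].
  rewrite FT; have [finF FB FV] := inv T (leqnn _).
  have [cB cV _] := selected_final_cut hP hL hsel FB (Xx _ (leqnn _)).
  by split; [rewrite finite_setU; split|exact: lower_modelU1].
rewrite FS//; have [finF FB FV] := inv t (ltnW tT).
have [cB cV _] := selected_cut hP hL hsel tT finS lmS (Xx _ (ltnW tT)).
split; first by rewrite finite_setU; split.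
apply: lower_modelU1 => // y; rewrite value_bellman//.
apply: le_ereal_inf_tmp => _ [u _ <-]; apply: le_trans (cV y u) _.
by apply: bellman_u_le; have [] := lmS.
Qed.

(** Both claims must be carried together: cuts are valid only at trial points of
    the state sets, and trial points stay there only if the models are valid. *)
Lemma run_invariants k :
  run_invariant k /\ forall t, (t <= T)%N -> state_set P t (x k t).
Proof.
elim: k => [|k [inv Xx]].
  split; last by have [] := hx.
  have [F0 _ _] := hF; move=> t tT; rewrite F0//; split => //.
  by move=> y; apply: ge_ereal_sup => _ [? []].
have lmS := run_step inv Xx.
split; first by move=> t /lmS[? []].
by apply: optimal_trajectory_in_states => // t /lmS[].
Qed.

Lemma trial_state k t : (t <= T)%N -> state_set P t (x k t).
Proof. exact: (run_invariants k).2. Qed.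

Lemma run_finite k t : (t <= T)%N -> finite_set (F k t).
Proof. by move=> /(run_invariants k).1[]. Qed.

Lemma run_le_value k t y : (t <= T)%N -> (sup_fun (F k t) y <= value P t y)%E.
Proof. by move=> /(run_invariants k).1[]. Qed.

Lemma run_lower_model k t : (0 < k)%N -> (t <= T)%N ->
  lower_model P L t (F k t).
Proof.
case: k => // k _ tT; have [inv Xx] := run_invariants k.
by have [] := run_step inv Xx tT.
Qed.

Lemma limit_lower_model t : (t <= T)%N -> lower_model P L t (limit_model F t).
Proof.
move=> tT; split.
- by move=> phi [k _]; have [_ FB _] := (run_invariants k).1 t tT; exact: FB.
- have [_ [phi Fphi] _] := @run_lower_model 1 t isT tT.
  by exists phi; exists 1%N.
- move=> y; apply: ge_ereal_sup => _ [phi [k _ Fphi] <-].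
  by apply: le_trans (run_le_value k y tT); apply: ereal_sup_ubound; exists phi.
Qed.

Lemma run_cvg t y : (t <= T)%N ->
  sup_fun (F k t) y @[k --> \oo] --> sup_fun (limit_model F t) y.
Proof.
move=> tT.
suff -> : sup_fun (limit_model F t) y =
    ereal_sup (range (fun k => sup_fun (F k t) y)).
  by apply: ereal_nondecreasing_cvgn; exact: run_nondecreasing.
apply/eqP; rewrite eq_le; apply/andP; split.
  apply: ge_ereal_sup => _ [phi [k _ Fphi] <-].
  apply: (@le_trans _ _ (sup_fun (F k t) y)).
    by apply: ereal_sup_ubound; exists phi.
  by apply: ereal_sup_ubound; exists k.
apply: ge_ereal_sup => _ [k _ <-]; apply: ereal_sup_le => _ [phi Fphi <-].
by exists phi => //; exists k.
Qed.

Lemma run_cvg_uniform t C e : (t <= T)%N -> compact C ->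
  C `<=` state_set P t -> 0 < e ->
  \forall k \near \oo, forall y, C y ->
    `|fine (sup_fun (F k t) y) - fine (sup_fun (limit_model F t) y)| < e.
Proof.
move=> tT cC CX e0.
apply: (@lipschitz_cvg_uniform _ _ _ (n%:R * `|L t|) _ _ cC) => //.
- exists 1%N => // k k0 y z /CX Xy /CX Xz.
  exact: (lower_model_lipschitz hP hL tT (run_lower_model k0 tT)).
- move=> y z /CX Xy /CX Xz.
  exact: (lower_model_lipschitz hP hL tT (limit_lower_model tT)).
- move=> y /CX Xy; apply: fine_cvg; rewrite fineK; first exact: run_cvg.
  exact: lower_model_fin (limit_lower_model tT) Xy.
Qed.

Lemma final_tight k : sup_fun (F k.+1 T) (x k T) = value P T (x k T).
Proof.
have [_ FT _] := hF; apply/eqP; rewrite eq_le run_le_value//=.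
have [_ FB _] := (run_invariants k).1 T (leqnn _).
have [_ _ <-] := selected_final_cut hP hL hsel FB (trial_state k (leqnn _)).
by apply: ereal_sup_ubound; rewrite FT; eexists; [right|].
Qed.

(** The same control [u], the one followed by the trajectory, bounds the new
    model from below and the value function from above at [x k t]; its cost
    cancels.  On the right the model has rank [k], not [k.+1]: the trajectory is
    optimal for the models of rank [k]. *)
Lemma gap_recursion k t : (0 < k)%N -> (t < T)%N ->
  fine (value P t (x k t)) - fine (sup_fun (F k.+1 t) (x k t)) <=
  fine (value P t.+1 (x k t.+1)) - fine (sup_fun (F k t.+1) (x k t.+1)).
Proof.
move=> k0 tT; have [_ _ FS] := hF.
have Xt := trial_state k (ltnW tT).
have XS := trial_state k tT.
have [_ /(_ k k0) [_ /(_ t tT) [u umin xS]]] := hx.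
have [_ _ [v vcut]] := selected_cut hP hL hsel tT (run_finite k.+1 tT)
  (run_lower_model (ltn0Sn k) tT) Xt.
have model_ge : (bellman_u P t u (sup_fun (F k t.+1)) (x k t) <=
    sup_fun (F k.+1 t) (x k t))%E.
  apply: le_trans (umin v) _.
  apply: (@le_trans _ _ (sel t (F k.+1 t.+1) (x k t) (x k t))).
    apply: le_trans vcut; apply: bellman_u_le => y.
    exact: run_nondecreasing.
  by apply: ereal_sup_ubound; rewrite FS//; eexists; [right|].
have value_le := value_le_bellman_u u (x k t) tT.
have Vt := value_fin hP hL (ltnW tT) Xt.
have VS := value_fin hP hL tT XS.
have Ft := lower_model_fin hP hL (ltnW tT)
  (run_lower_model (ltn0Sn k) (ltnW tT)) Xt.
have FSfin := lower_model_fin hP hL tT (run_lower_model k0 tT) XS.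
have [FB F0 _] := run_lower_model k0 tT.
have lt_sum : (bellman_u P t u (sup_fun (F k t.+1)) (x k t) < +oo)%E.
  by apply: le_lt_trans model_ge _; move: Ft; rewrite fin_numElt => /andP[].
have [_ [cfin _] _] :=
  bellman_u_lty hP tT (fun y => sup_basic_notin FB F0) lt_sum.
rewrite /edom/= in cfin.
move: model_ge value_le; rewrite /bellman_u -xS.
rewrite -(fineK Vt) -(fineK VS) -(fineK Ft) -(fineK FSfin) -(fineK cfin).
rewrite -!dEFinD !lee_fin /=; lra.
Qed.

(** [gap_recursion] compares with the model of rank [k] at time [t.+1], the
    induction hypothesis with that of rank [k.+1]; uniform convergence on the
    state set makes their difference small at the moving point [x k t.+1]. *)
Lemma gap_cvg0 t : (t <= T)%N -> forall e, 0 < e -> \forall k \near \oo,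
  fine (value P t (x k t)) - fine (sup_fun (F k.+1 t) (x k t)) < e.
Proof.
move: t; apply: backward_ind => [e e0|t tT IH e e0].
  by near=> k; rewrite final_tight subrr.
have e4 : 0 < e / 4 by rewrite divr_gt0.
have uni := run_cvg_uniform tT (state_compact hP tT) (@subset_refl _ _) e4.
have uniS : \forall k \near \oo, forall y, state_set P t.+1 y ->
    `|fine (sup_fun (F k.+1 t.+1) y) -
      fine (sup_fun (limit_model F t.+1) y)| < e / 4.
  move: uni => [N _ uni]; exists N => // k /= Nk.
  by apply: uni; rewrite /= leqW.
near=> k.
have k0 : (0 < k)%N by near: k; exists 1%N.
apply: le_lt_trans (gap_recursion k0 tT) _.
have XS := trial_state k tT.
have : `|fine (sup_fun (F k t.+1) (x k t.+1)) -
         fine (sup_fun (limit_model F t.+1) (x k t.+1))| < e / 4.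
  by move: (x k t.+1) XS; near: k.
have : `|fine (sup_fun (F k.+1 t.+1) (x k t.+1)) -
         fine (sup_fun (limit_model F t.+1) (x k t.+1))| < e / 4.
  by move: (x k t.+1) XS; near: k.
have : fine (value P t.+1 (x k t.+1)) -
       fine (sup_fun (F k.+1 t.+1) (x k t.+1)) < e / 4.
  by near: k; exact: IH.
rewrite !ltr_norml => ? /andP[? ?] /andP[? ?]; lra.
Unshelve. all: by end_near. Qed.

(** At trial points close to [y] the model, hence its limit, is close to the
    value function; both are Lipschitz, so this passes to [y]. *)
Lemma limit_model_cluster t y : (t <= T)%N -> cluster (x k t @[k --> \oo]) y ->
  sup_fun (limit_model F t) y = value P t y.
Proof.
move=> tT ycl.
have Xy : state_set P t y.
  have cX : closed (state_set P t).
    by apply: compact_closed (state_compact hP tT); exact: norm_hausdorff.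
  apply: cX => B By; apply: ycl => //.
  by exists 0%N => // k _; exact: trial_state.
have lmt := limit_lower_model tT.
have Vfin := value_fin hP hL tT Xy.
have Ffin := lower_model_fin hP hL tT lmt Xy.
apply/eqP; rewrite eq_le; apply/andP; split; first by have [_ _] := lmt.
rewrite -(fineK Vfin) -(fineK Ffin) lee_fin.
apply/ler_addgt0Pr => e e0.
have e3 : 0 < e / 3 by rewrite divr_gt0.
pose K := n%:R * `|L t|.
have K1 : 0 < K + 1 by rewrite ltr_wpDl// mulr_ge0.
have d0 : 0 < e / 3 / (K + 1) by rewrite divr_gt0.
have yd : nbhs y (ball y (e / 3 / (K + 1))) by exact: nbhsx_ballx.
have /(_ _ _ _ yd) := ycl.
move=> /(_ (x^~ t @` [set k | (fine (value P t (x k t)) -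
  fine (sup_fun (F k.+1 t) (x k t)) < e / 3)])) [].
  by apply: filterS (gap_cvg0 tT e3) => k gap_k; exists k.
(* One index [k] with a small gap and [x k t] near [y] is enough. *)
move=> _ [[k /= gap_k <-]]; rewrite -ball_normE/= => yx.
have Xx := trial_state k tT.
have xlt : K * `|y - x k t| <= e / 3.
  apply: (@le_trans _ _ (`|y - x k t| * (K + 1))).
    by rewrite mulrC ler_wpM2l// lerDl.
  by rewrite -ler_pdivlMr// ltW.
have := value_lipschitz hP hL tT Xy Xx.
have := lower_model_lipschitz hP hL tT lmt Xy Xx.
have : fine (sup_fun (F k.+1 t) (x k t)) <=
    fine (sup_fun (limit_model F t) (x k t)).
  rewrite -lee_fin !fineK ?(lower_model_fin hP hL tT lmt Xx)//.
    by apply: ereal_sup_le => _ [phi Fphi <-]; exists phi => //; exists k.+1.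
  exact: (lower_model_fin hP hL tT (run_lower_model (ltn0Sn k) tT) Xx).
rewrite -/K => model_le.
rewrite !ler_norml => /andP[? ?] /andP[? ?]; lra.
Qed.

End Convergence.

Theorem theorem21 (R : realType) (n m : nat) (P : lc_data R n m)
    (hP : linear_convex P)
    (x0 : 'cV[R]_n) (hx0 : state_set P 0%N x0)
    (L : nat -> R) (hL : lip_constants P L)
    (sel : nat -> set ('cV[R]_n -> \bar R) -> 'cV[R]_n -> ('cV[R]_n -> \bar R))
    (hsel : sddp_selection P L sel)
    (x : nat -> nat -> 'cV[R]_n)
    (F : nat -> nat -> set ('cV[R]_n -> \bar R))
    (hF : tdp_run P sel x F)
    (hx : optimal_trials P x0 (fun k t => sup_fun (F k t)) x)
    (t : nat) (ht : (t <= horizon P)%N) :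
  exists Vstar : 'cV[R]_n -> \bar R,
    [/\ forall y, nondecreasing_seq (fun k => sup_fun (F k t) y),
        forall k y, (sup_fun (F k t) y <= value P t y)%E,
        forall C : set 'cV[R]_n, compact C -> C `<=` edom (value P t) ->
          cvg_uniformly_on C (fun k => sup_fun (F k t)) Vstar &
        forall y, limsup_set (fun k => [set x k t]) y ->
          Vstar y = value P t y].
Proof.
exists (sup_fun (limit_model F t)); split.
- by move=> y; exact: (run_nondecreasing hF y ht).
- by move=> k y; exact: (run_le_value hP hL hsel hx0 hF hx).
- move=> C cC Cdom.
  have CX : C `<=` state_set P t.
    by have [_ <- _] := value_regular hP hL ht.
  apply: cvg_uniformly_onP.
  (* The model of rank 0 is the empty supremum -oo. *)
  + exists 1%N => // k k0 y /CX.
    apply: (lower_model_fin hP hL ht).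
    exact: (run_lower_model hP hL hsel hx0 hF hx k0 ht).
  + move=> y /CX.
    apply: (lower_model_fin hP hL ht).
    exact: (limit_lower_model hP hL hsel hx0 hF hx ht).
  + by move=> e; exact: (run_cvg_uniform hP hL hsel hx0 hF hx ht cC CX).
- move=> y [z [zx]]; have -> : z = x^~ t by apply/funext => k; exact: zx.
  exact: (limit_model_cluster hP hL hsel hx0 hF hx ht).
Qed.
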